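(* Let $m\ge 1$ be an integer, let $b_1,\dots,b_m$ be positive real numbers with $\sum_{j=1}^m b_j>1$, and let $m_1,\dots,m_m\ge 2$ be integers such that $\frac{\log m_j}{\log m_\ell}\notin\mathbb{Q}$ for some $j,\ell$. Let $s_0$ be the positive root of the equation $\sum_{j=1}^m b_j m_j^{-s}=1$. Let $(a_n)_{n\ge 0}$ be a sequence of independent real random variables, and let $(X_n)_{n\ge 0}$ be defined by $X_0=a_0$ and $X_n=a_n+\sum_{j=1}^m b_j X_{\lfloor n/m_j\rfloor}$ for $n\ge 1$. (1) If there exists a probability distribution $\mu$ with exponential moments such that $|a_n|$ is stochastically dominated by $\mu^{*n}$ for each $n\ge 0$, then $|X_n|$ has exponential moments for each $n$. (2) If $s_0>1$ (or equivalently $\sum_{j=1}^m \frac{b_j}{m_j}>1$) and there exists a probability distribution $\mu$ with exponential moments such that $|a_n|$ is stochastically dominated by $\mu$ for each $n\ge 0$, then $\frac{X_n}{n^{s_0}}$ converges almost surely, as $n\to+\infty$, to a random variable $L$ such that $|L|$ has exponential moments. (3) If $s_0>2$ (or equivalently $\sum_{j=1}^m \frac{b_j}{m_j^2}>1$) and there exists a probability distribution $\mu$ with exponential moments such that $|a_n|$ is stochastically dominated by $\mu^{*n}$ for each $n\ge 0$, then $\frac{X_n}{n^{s_0}}$ converges almost surely, as $n\to+\infty$, to a random variable $L$ such that $|L|$ has exponential moments.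
   Context: $\lfloor x\rfloor$ denotes the integer part of $x$. $\mu^{*n}$ denotes the $n$-fold convolution of $\mu$ with itself, with $\mu^{*0}$ the Dirac mass at $0$. A random variable $Z$ is stochastically dominated by a probability distribution $\nu$ on $\mathbb{R}$ if $\mathbb{P}(Z\ge t)\le \nu([t,+\infty))$ for every $t\in\mathbb{R}$. A random variable $Z$ (or its distribution) has exponential moments if there exists $\alpha>0$ with $\mathbb{E}(e^{\alpha|Z|})<+\infty$. *)

(* Defs.v *)
From HB Require Import structures.
From mathcomp Require Import all_boot all_order all_algebra.
From mathcomp Require Import finmap.
From mathcomp Require Import all_classical all_reals all_analysis.

Set Implicit Arguments.
Unset Strict Implicit.
Unset Printing Implicit Defensive.

Import Order.TTheory GRing.Theory Num.Theory.
Import numFieldNormedType.Exports.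

Local Open Scope classical_set_scope.
Local Open Scope ring_scope.

Definition add_pair (R : realType) (z : R * R) : R := z.1 + z.2.

Lemma measurable_add_pair (R : realType) :
  measurable_fun [set: (R * R)%type] (@add_pair R).
Proof.
by apply: measurable_realfun.measurable_funD;
  [exact: measurable_fst|exact: measurable_snd].
Qed.

HB.instance Definition _ (R : realType) :=
  @isMeasurableFun.Build _ _ (R * R)%type R (@add_pair R)
    (@measurable_add_pair R).

Definition convolution (R : realType) (mu nu : probability R R) :
  probability R R := distribution (mu \x nu)%E (@add_pair R).

Definition conv_pow (R : realType) (mu : probability R R) (n : nat) :
  probability R R := iter n (convolution mu) (\d_(0 : R) : probability R R).

(* [Z] is an arbitrary function so that the predicates below apply to |Z|
   without repackaging it as a random variable. *)
Definition stoch_dominated d (T : measurableType d) (R : realType)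
    (P : probability T R) (Z : T -> R) (nu : probability R R) : Prop :=
  forall t : R, (P [set w | (t <= Z w)%R] <= nu `[t, +oo[%classic)%E.

Definition exp_moments d (T : measurableType d) (R : realType)
    (P : probability T R) (Z : T -> R) : Prop :=
  exists2 alpha : R, 0 < alpha & ('E_P[fun w => expR (alpha * `|Z w|)] < +oo)%E.

Definition law_exp_moments (R : realType) (mu : probability R R) : Prop :=
  exp_moments mu (fun x : R => x).

Definition independent_seq d (T : measurableType d) (R : realType)
    (P : probability T R) (a : nat -> {RV P >-> R}) : Prop :=
  forall (J : {fset nat}) (B : nat -> set R), (forall i, measurable (B i)) ->
    P (\bigcap_(i in [set` J]) (a i @^-1` B i)) =
    (\prod_(i <- J) P (a i @^-1` B i))%E.

(* Main.v *)
Require Import Defs.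
From HB Require Import structures.
From mathcomp Require Import all_boot all_order all_algebra.
From mathcomp Require Import all_classical all_reals all_analysis.
From mathcomp Require Import measurable_realfun.
From mathcomp Require Import ring lra zify.
Import Order.TTheory GRing.Theory Num.Theory.
Import numFieldNormedType.Exports.
Local Open Scope classical_set_scope.
Local Open Scope ring_scope.

(** The recursion is linear, so [X n] is an explicit combination of the inputs,
    [X n = \sum_(i <= n) G n i * a i] with deterministic coefficients.  All of
    them come from the single sequence [Z] with [Z 0 = 1] and
    [Z n = \sum_j b_j Z (n %/ k_j)] for [n >= 1]: one finds [G n 0 = Z n] and
    [G n i = (Z (n %/ i) - Z (n %/ i.+1)) / (\sum_j b_j - 1)] for [i >= 1],
    because iterated floor divisions commute ([recursion_expansion]).

    The growth of [Z] is a renewal problem.  In logarithmic scale,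
    [h t = Z (floor (e ^ t)) * e ^ (- s0 * t)] satisfies, for [t >= 0],
    [h t = \sum_j p_j h (t - ln k_j)] with [p_j = b_j k_j ^ (- s0)], and
    [\sum_j p_j = 1] by the choice of [s0].  Two ideas give the convergence of
    [h] ([renewal_limit]).  At a time where [h] almost equals its upper limit
    [S], an average of past values is almost maximal, hence every one of them is;
    going back step by step, [h] is almost [S] at that time shifted back by any
    given element of the semigroup generated by the [ln k_j].  Two of these logarithms have an
    irrational ratio, so this semigroup contains arbitrarily fine ladders covering
    a whole window of memory ([semigroup_ladder]), and since [Z] is nondecreasing
    [h] cannot fall quickly between two rungs: [h] is almost at least [S] on the
    window.  A lower bound on one window persists forever, as every later value
    is an average of earlier ones.  So [h] tends to [S], whence
    [G n i / n ^ s0] has a limit for each [i], and the maximum principle also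
    gives [`|G n i| <= C (n / i) ^ s0] ([homogeneous_asymptotics]).

    It follows that [X n / n ^ s0] converges as soon as
    [\sum_i i ^ (- s0) `|a i|] is finite, by dominated convergence of series
    ([tannery]).  Moments and finiteness are both obtained from one integrable
    variable ([exp_majorant]): if nonnegative weights [w i] have sum at most [1] and
    the [expR (U i)] have uniformly bounded expectations, then convexity gives
    [expR (\sum_i w i U i) <= 1 + \sum_i w i expR (U i)], whose right-hand side
    has finite expectation.  If the law of [`|a i|] is dominated by [mu], the
    variables [U i = alpha `|a i|] qualify, and the weights [i ^ (- s0)] are
    summable when [s0 > 1].  If it is dominated by the [i]-fold convolution of
    [mu], one has to take [U i = alpha `|a i| / i], since the exponential moment
    of order [alpha / i] of that convolution is bounded in [i]
    ([mgf_pow_bounded]); the weights become [i ^ (1 - s0)], which are summable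
    when [s0 > 2].  For a fixed [n] the sum is finite and every [s0] is allowed,
    which is the first assertion. *)

Set Implicit Arguments.
Unset Strict Implicit.
Unset Printing Implicit Defensive.

(** * Ladders in a semigroup with two incommensurable generators *)

(** Dirichlet's pigeonhole argument: among the fractional parts of the
    multiples [i * (x / y)] with [i <= N], two lie in the same interval of length
    [1 / N], where [N] is chosen with [y / N < e].  Their difference does not
    vanish because [x / y] is irrational. *)
Lemma small_combination (R : realType) (x y e : R) : 0 < x -> 0 < y -> 0 < e ->
  irrational (x / y) ->
  exists u v : nat, 0 < `|u%:R * x - v%:R * y| < e.
Proof.
move=> x0 y0 e0 irr; set th := x / y.
have th0 : 0 < th by rewrite divr_gt0.
pose N := (Num.truncn (y / e)).+1.
have N0 : 0 < N%:R :> R by rewrite ltr0n.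
have yN : y / N%:R < e by rewrite ltr_pdivrMr// mulrC -ltr_pdivrMr// truncnS_gt.
pose fr (i : nat) := i%:R * th - (Num.truncn (i%:R * th))%:R.
have fr01 i : 0 <= fr i < 1.
  have /truncn_itv/andP[h1 h2] : 0 <= i%:R * th by rewrite mulr_ge0 ?ler0n// ltW.
  by rewrite subr_ge0 h1/= ltrBlDr -natr1 addrC in h2 *.
have frN i : (Num.truncn (N%:R * fr i) < N)%N.
  have /andP[h1 h2] := fr01 i.
  by rewrite truncn_lt_nat ?mulr_ge0 ?ler0n// -[ltRHS]mulr1 ltr_pM2l.
pose f (i : 'I_N.+1) : 'I_N := Ordinal (frN i).
have : ~~ injectiveb f.
  apply/negP => /injectiveP/leq_card; by rewrite !card_ord ltnn.
move=> /injectivePn[i0 [j0 ij0 fij0]].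
have [i [j [ij fij]]] : exists i j : nat, (i < j)%N /\
    Num.truncn (N%:R * fr i) = Num.truncn (N%:R * fr j).
  have e1 := congr1 val fij0; rewrite /= in e1.
  have [h|h|/val_inj h] := ltngtP i0 j0.
  - by exists i0, j0.
  - by exists j0, i0.
  - by rewrite h eqxx in ij0.
have iN : `|fr j - fr i| < N%:R^-1.
  have Nfr l : 0 <= N%:R * fr l by rewrite mulr_ge0 ?ler0n//; case/andP: (fr01 l).
  have /andP[a1 a2] := truncn_itv (Nfr i).
  have /andP[a3 a4] := truncn_itv (Nfr j).
  rewrite fij -natr1 in a1 a2; rewrite -natr1 in a4.
  rewrite -(ltr_pM2l N0) divff ?gt_eqF//.
  rewrite -{1}(gtr0_norm N0) -normrM mulrBr ltr_norml; apply/andP; split; lra.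
have tij : (Num.truncn (i%:R * th) <= Num.truncn (j%:R * th))%N.
  by apply: le_truncn; rewrite ler_pM2r// ler_nat ltnW.
exists (j - i)%N, (Num.truncn (j%:R * th) - Num.truncn (i%:R * th))%N.
have -> : (j - i)%:R * x -
    (Num.truncn (j%:R * th) - Num.truncn (i%:R * th))%N%:R * y =
    (fr j - fr i) * y.
  have -> : x = th * y by rewrite /th divfK ?gt_eqF.
  rewrite !natrB// ?(ltnW ij)// /fr; ring.
rewrite normrM (gtr0_norm y0); apply/andP; split; last first.
  apply: le_lt_trans yN; rewrite mulrC ler_pM2l//; exact: ltW.
rewrite mulr_gt0// normr_gt0; apply/eqP => h.
apply: irr; rewrite /= -/th.
exists ((Num.truncn (j%:R * th) - Num.truncn (i%:R * th))%N%:R / (j - i)%N%:R) => //.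
rewrite fmorph_div /= !rmorph_nat !natrB// ?(ltnW ij)//.
have ji : j%:R - i%:R != 0 :> R by rewrite subr_eq0 eqr_nat gt_eqF.
apply/(mulIf ji); rewrite divfK//; move: h; rewrite /fr; lra.
Qed.

(** If [D = u x - v y] is small and positive, exchanging [v] copies of [y] for
    [u] copies of [x] climbs by [D]; starting from [N v] copies of [y], this can
    be done [N] times.  When [D] is negative, [x] and [y] exchange roles. *)
Lemma semigroup_ladder (R : realType) (x y e W : R) : 0 < x -> 0 < y -> 0 < e ->
  irrational (x / y) ->
  exists d A (N : nat), [/\ 0 < d < e, W <= N%:R * d &
    forall i, (i <= N)%N -> exists u v : nat, A + i%:R * d = u%:R * x + v%:R * y].
Proof.
move=> x0 y0 e0 /(small_combination x0 y0 e0)[u [v]].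
set D := _ - _ => /andP[D0 De].
pose N := (Num.truncn (W / `|D|)).+1.
have WN : W <= N%:R * `|D| by rewrite -ler_pdivrMr// ltW// truncnS_gt.
have [Dp|Dn] := leP 0 D.
- exists D, (N%:R * (v%:R * y)), N; rewrite ger0_norm// in D0 De WN; split=> //.
  + by rewrite D0.
  + move=> i iN; exists (i * u)%N, ((N - i) * v)%N.
    rewrite !natrM natrB// /D; ring.
- exists (- D), (N%:R * (u%:R * x)), N; rewrite ltr0_norm// in D0 De WN; split=> //.
  + by rewrite D0.
  + move=> i iN; exists ((N - i) * u)%N, (i * v)%N.
    rewrite !natrM natrB// /D; ring.
Qed.

(** * The renewal equation *)

(** Minimum principle: a value [h t] is an average of values taken at least
    [lmin] earlier, so that a lower bound spreads to the right of its window in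
    steps of length [lmin]. *)
Lemma renewal_ge (R : realType) (m : nat) (p lam : 'I_m -> R) (h : R -> R)
    (lmin lmax c T : R) :
  (forall j, 0 < p j) -> \sum_j p j = 1 ->
  0 < lmin -> (forall j, lmin <= lam j <= lmax) ->
  (forall t, 0 <= t -> h t = \sum_j p j * h (t - lam j)) ->
  0 <= T -> (forall t, T - lmax <= t < T -> c <= h t) ->
  forall t, T - lmax <= t -> c <= h t.
Proof.
move=> p0 p1 l0 lamP hrec T0 hT.
have step n t : T - lmax <= t < T + n%:R * lmin -> c <= h t.
  elim: n t => [|n ih] t; first by rewrite mul0r addr0; exact: hT.
  move=> /andP[t1 t2]; have [tT|tT] := ltP t T; first by apply: hT; rewrite t1.
  rewrite hrec ?(le_trans T0)// -[leLHS]mul1r -p1 mulr_suml; apply: ler_sum => j _.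
  rewrite ler_pM2l//; apply: ih.
  have /andP[h1 h2] := lamP j.
  move: t2; rewrite -natr1; lra.
move=> t tT; apply: (step (Num.truncn ((t - T) / lmin)).+1).
rewrite tT -ltrBlDl -ltr_pdivrMr//; exact: truncnS_gt.
Qed.

Lemma renewal_le (R : realType) (m : nat) (p lam : 'I_m -> R) (h : R -> R)
    (lmin lmax c T : R) :
  (forall j, 0 < p j) -> \sum_j p j = 1 ->
  0 < lmin -> (forall j, lmin <= lam j <= lmax) ->
  (forall t, 0 <= t -> h t = \sum_j p j * h (t - lam j)) ->
  0 <= T -> (forall t, T - lmax <= t < T -> h t <= c) ->
  forall t, T - lmax <= t -> h t <= c.
Proof.
move=> p0 p1 l0 lamP hrec T0 hT t tT; rewrite -lerN2.
apply: (@renewal_ge _ _ p lam (fun t => - h t) _ _ _ _ p0 p1 l0 lamP _ T0) => //.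
- move=> u u0; rewrite hrec// -sumrN; apply: eq_bigr => j _; exact: esym (mulrN _ _).
- by move=> u uT; rewrite lerN2; exact: hT.
Qed.

(** The upper limit at infinity, in the form used by the renewal theorem: an
    eventual upper bound that is nearly reached at arbitrarily large times. *)
Lemma limsup_attained (R : realType) (h : R -> R) (C : R) :
  (forall t, 0 <= h t) -> (forall t, 0 <= t -> h t <= C) ->
  exists S, [/\ 0 <= S,
    forall e, 0 < e -> \forall t \near +oo, h t < S + e &
    forall e T, 0 < e -> exists2 t, T <= t & S - e < h t].
Proof.
move=> h0 hC; pose A := [set c | exists T, forall t, T <= t -> h t <= c].
have lbA : lbound A 0.
  move=> c [T hT]; exact: le_trans (h0 T) (hT T (lexx _)).
have infA : has_inf A.
  by split; [exists C, 0 => t; exact: hC|exists 0].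
exists (inf A); split.
- exact: lb_le_inf infA.1 lbA.
- move=> e e0; have [c [T hT] ce] := inf_adherent e0 infA.
  exists T; split; first exact: num_real.
  by move=> t /ltW /hT /le_lt_trans; exact.
- move=> e T e0; apply: contrapT => hn.
  suff /(ge_inf infA.2) : A (inf A - e) by lra.
  exists T => t Tt; rewrite leNgt; apply/negP => ht; apply: hn; by exists t.
Qed.

(** The upper limit [S] of [h] is its limit.  Along a sequence [t_] where [h]
    tends to [S], the property [Q s] says that [h] still does not fall below [S]
    in the limit at the times [t_ n - s].  It is stable under [s |-> s + lam j], because an
    average with weights bounded away from [0] cannot be close to an upper bound
    of its terms unless all of them are.  Hence [h] is almost [S] on all rungs of
    a ladder as long as the memory [lmax], and the lower bound on the growth of
    [h] extends this to the window between the rungs, hence to all later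
    times. *)
Lemma renewal_limit (R : realType) (m : nat) (p lam : 'I_m -> R) (h : R -> R)
    (lmin lmax sig C : R) (j1 j2 : 'I_m) :
  (forall j, 0 < p j) -> \sum_j p j = 1 ->
  0 < lmin -> (forall j, lmin <= lam j <= lmax) ->
  (forall t, 0 <= t -> h t = \sum_j p j * h (t - lam j)) ->
  (forall t, 0 <= h t) -> (forall t, 0 <= t -> h t <= C) ->
  0 < sig -> (forall t d, 0 <= d -> expR (- (sig * d)) * h t <= h (t + d)) ->
  irrational (lam j1 / lam j2) ->
  exists S : R, h t @[t --> +oo] --> S.
Proof.
move=> p0 p1 l0 lamP hrec h0 hC sig0 hslow irr.
have lam0 j : 0 < lam j by case/andP: (lamP j) => h1 _; exact: lt_le_trans h1.
have [S [S0 Sup Slo]] := limsup_attained h0 hC.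
have /choice[t_ t_P] : forall n : nat, exists t, n%:R <= t /\ S - n.+1%:R^-1 < h t.
  by move=> n; have [|t nt ht] := Slo (n.+1%:R^-1) n%:R; [rewrite invr_gt0|exists t].
have t_y s T : \forall n \near \oo, T <= t_ n - s.
  near=> n; rewrite lerBrDr; apply: le_trans (t_P n).1.
  near: n; exact: nbhs_infty_ger.
pose Q s := forall eta, 0 < eta -> \forall n \near \oo, S - eta < h (t_ n - s).
have Q0 : Q 0.
  move=> eta eta0; near=> n; rewrite subr0; apply: lt_trans (t_P n).2.
  rewrite ltrD2l ltrN2; near: n; exact: near_infty_natSinv_lt (PosNum eta0).
have Qstep s j : Q s -> Q (s + lam j).
  move=> Qs eta eta0; pose e := p j * eta / 2.
  have e0 : 0 < e by rewrite /e divr_gt0// mulr_gt0.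
  have [T [_ hT]] := Sup _ e0.
  near=> n.
  have ts0 : 0 <= t_ n - s by near: n; exact: t_y.
  have tsT : T + lmax + 1 <= t_ n - s by near: n; exact: t_y.
  have hs : S - e < h (t_ n - s) by near: n; exact: Qs.
  have hi i : h (t_ n - s - lam i) <= S + e.
    by apply/ltW/hT; case/andP: (lamP i) => h1 h2; lra.
  rewrite hrec// (bigD1 j)//= in hs.
  have : \sum_(i < m | i != j) p i * h (t_ n - s - lam i) <= (1 - p j) * (S + e).
    have -> : 1 - p j = \sum_(i < m | i != j) p i.
      by rewrite -p1 [X in X - _](bigD1 j)//= [p j + _]addrC addrK.
    rewrite mulr_suml.
    by apply: ler_sum => i _; rewrite ler_pM2l.
  move: hs; rewrite opprD addrA.
  move: (h _) (\sum_(i < m | _) _) => q q' hs hq'.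
  rewrite -(ltr_pM2l (p0 j)).
  have pe : 0 < p j * e by rewrite mulr_gt0.
  have ee : p j * eta = 2 * e by rewrite /e; field.
  rewrite mulrBr ee; lra.
have Quv u v : Q (u%:R * lam j1 + v%:R * lam j2).
  elim: u => [|u ih].
    elim: v => [|v ih]; first by rewrite !mul0r addr0.
    by rewrite -natr1 mulrDl mul1r addrA; exact: Qstep.
  by rewrite -natr1 mulrDl mul1r addrAC; exact: Qstep.
exists S; apply/cvgrPdist_le => e e0.
suff low : \forall t \near +oo, S - e <= h t.
  near=> t; rewrite ler_norml; apply/andP; split; last first.
    by rewrite lerBlDr addrC -lerBlDr; near: t.
  have : h t < S + e by near: t; exact: Sup.
  lra.
pose eta := e / 2.
(* The mesh is such that the loss [1 - expR (- sig * d)] costs at most [eta]. *)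
pose dl := Num.min sig^-1 (eta / (sig * (S + 1))).
have eta0 : 0 < eta by rewrite divr_gt0.
have S1 : 0 < S + 1 by rewrite ltr_wpDl.
have dl0 : 0 < dl by rewrite lt_min invr_gt0 sig0 divr_gt0// mulr_gt0.
have [d [A [N [/andP[d0 ddl] WN lad]]]] :=
  semigroup_ladder lmax (lam0 j1) (lam0 j2) dl0 irr.
have hlad : \forall n \near \oo, forall i : 'I_N.+1,
    S - eta < h (t_ n - (A + i%:R * d)).
  apply: filter_forall => i; have [u [v ->]] := lad i (ltn_ord i).
  exact: Quv.
have [n [hn tn0]] : exists n, (forall i : 'I_N.+1,
    S - eta < h (t_ n - (A + i%:R * d))) /\ 0 <= t_ n - A.
  by apply: (@filter_ex _ \oo); near=> n; split; near: n => //; exact: t_y.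
have sd1 : sig * d <= 1.
  rewrite -(divff (lt0r_neq0 sig0)) ler_pM2l// ltW//.
  by move: ddl; rewrite lt_min => /andP[].
have sdS : sig * d * S <= eta.
  have : d <= eta / (sig * (S + 1)) by move: ddl; rewrite lt_min => /andP[_ /ltW].
  rewrite ler_pdivlMr ?mulr_gt0//; nra.
have win t : t_ n - A - lmax <= t < t_ n - A -> S - e <= h t.
  move=> /andP[t1 t2].
  (* Rung [i] is the last one that does not precede [t]. *)
  pose i := Num.truncn ((t_ n - A - t) / d).
  have td0 : 0 <= (t_ n - A - t) / d by rewrite divr_ge0 ?(ltW d0)//; lra.
  have /andP[i1 i2] := truncn_itv td0; rewrite -/i in i1 i2.
  rewrite ler_pdivlMr// in i1; rewrite ltr_pdivrMr// in i2.
  have [iN|Ni] := ltnP i N; last first.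
    (* The ladder is at least as long as the window: [t] is the last rung. *)
    have : N%:R * d <= i%:R * d by rewrite ler_pM2r// ler_nat.
    move=> Nid.
    have tt : t = t_ n - (A + (@Ordinal N.+1 N (ltnSn N))%:R * d) by rewrite /=; lra.
    rewrite tt; apply: ltW (le_lt_trans _ (hn _)).
    rewrite /eta; lra.
  have := hn (@Ordinal N.+1 i.+1 iN); rewrite /=.
  set s := t_ n - _ => hs.
  have ts : 0 <= t - s by rewrite /s; lra.
  have tsd : t - s <= d by move: i1 i2; rewrite /s -natr1; lra.
  have := hslow s (t - s) ts; rewrite [s + _]addrC subrK; apply: le_trans.
  have : (1 - sig * d) * h s <= expR (- (sig * (t - s))) * h s.
    rewrite ler_wpM2r//; apply: le_trans (expR_ge1Dx _).
    by rewrite lerD2l lerN2 ler_pM2l.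
  apply: le_trans.
  apply: (@le_trans _ _ ((1 - sig * d) * (S - eta))); last first.
    by apply: ler_wpM2l; [rewrite subr_ge0|exact: ltW].
  have : 0 <= sig * d * eta by rewrite !mulr_ge0// ltW.
  rewrite /eta in sdS *; lra.
near=> t.
apply: (renewal_ge p0 p1 l0 lamP hrec tn0 win).
near: t; exact: nbhs_pinfty_ge (num_real _).
Unshelve. all: by end_near.
Qed.

(** * Growth of the homogeneous recursion *)

Lemma truncn_divn (R : realType) (x : R) (k : nat) : 0 <= x -> (0 < k)%N ->
  Num.truncn (x / k%:R) = (Num.truncn x %/ k)%N.
Proof.
move=> x0 k0; have k0R : 0 < k%:R :> R by rewrite ltr0n.
apply: truncn_def; have /andP[x1 x2] := truncn_itv x0.
rewrite ler_pdivlMr// ltr_pdivrMr// -!natrM; apply/andP; split.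
  by apply: le_trans x1; rewrite ler_nat leq_divM.
by apply: lt_le_trans x2 _; rewrite ler_nat ltn_ceil.
Qed.

(** The recursive calls are at the smaller arguments [n %/ k j]; the first
    argument of [Y] is a bound on the recursion depth. *)
Lemma exists_homogeneous (R : realType) (m : nat) (b : 'I_m -> R) (k : 'I_m -> nat) :
  (forall j, (2 <= k j)%N) ->
  exists Z : nat -> R, Z 0%N = 1 /\
    forall n, (0 < n)%N -> Z n = \sum_j b j * Z (n %/ k j)%N.
Proof.
move=> k2.
pose fix Y (fuel n : nat) {struct fuel} : R := if fuel is f.+1 then
  if n is 0%N then 1 else \sum_j b j * Y f (n %/ k j)%N else 1.
have divlt n j : (0 < n)%N -> (n %/ k j < n)%N by move=> n0; rewrite ltn_Pdiv.
have YE f : forall g n, (n <= f)%N -> (n <= g)%N -> Y f n = Y g n.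
  elim: f => [|f ih] [|g] [|n]//= nf ng.
  apply: eq_bigr => j _; congr (_ * _); have nj := divlt n.+1 j isT.
  by apply: ih; rewrite -ltnS (leq_trans nj).
exists (fun n => Y n n); split=> // -[//|n] _ /=.
apply: eq_bigr => j _; congr (_ * _); have nj := divlt n.+1 j isT.
exact: YE.
Qed.

Lemma homogeneous_nondecreasing (R : realType) (m : nat) (b : 'I_m -> R)
    (k : 'I_m -> nat) (Z : nat -> R) :
  (forall j, 0 < b j) -> 1 <= \sum_j b j -> (forall j, (2 <= k j)%N) ->
  Z 0%N = 1 -> (forall n, (0 < n)%N -> Z n = \sum_j b j * Z (n %/ k j)%N) ->
  {homo Z : n n' / (n <= n')%N >-> n <= n'}.
Proof.
move=> b0 b1 k2 Z0 Zrec.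
have divlt n j : (0 < n)%N -> (n %/ k j < n)%N by move=> n0; rewrite ltn_Pdiv.
have Z1 n : 1 <= Z n.
  elim/ltn_ind: n => -[|n] ih; first by rewrite Z0.
  rewrite Zrec//; apply: le_trans b1 _; apply: ler_sum => j _.
  by rewrite ler_peMr ?(ltW (b0 j))// ih// divlt.
move=> n n'; elim/ltn_ind: n' n => -[|n'] ih [|n] nn'//; first by rewrite Z0.
rewrite !Zrec//; apply: ler_sum => j _; rewrite ler_pM2l//.
by apply: ih; [exact: divlt|exact: leq_div2r].
Qed.

(** The renewal theorem in the variable [t = ln x], applied to
    [h t = Z (floor x) / x ^ s0]: the floor of [x / k j] is the quotient of the
    floor of [x] by [k j], so that the recursion becomes a renewal equation
    valid for every real [t >= 0].  On the initial window, where [x < 1], [Z] is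
    [1] and [h] is at most [expR (s0 * lmax)]; this bound then propagates.  Since
    the quotient [n %/ i] is the floor of [n / i], the general limit is the one
    for [i = 1] shifted by [ln i]. *)
Lemma homogeneous_asymptotics (R : realType) (m : nat) (b : 'I_m -> R)
    (k : 'I_m -> nat) (s0 : R) (Z : nat -> R) :
  (forall j, 0 < b j) -> 1 <= \sum_j b j -> (forall j, (2 <= k j)%N) ->
  (exists j l : 'I_m, irrational (ln (k j)%:R / ln (k l)%:R : R)) ->
  0 < s0 -> \sum_j b j * (k j)%:R `^ (- s0) = 1 ->
  Z 0%N = 1 -> (forall n, (0 < n)%N -> Z n = \sum_j b j * Z (n %/ k j)%N) ->
  exists C S : R, [/\ 0 < C,
    forall n, (0 < n)%N -> Z n <= C * n%:R `^ s0 &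
    forall i, (0 < i)%N ->
      Z (n %/ i)%N / n%:R `^ s0 @[n --> \oo] --> S * i%:R `^ (- s0)].
Proof.
move=> b0 b1 k2 [j1 [j2 irr]] s0p root Z0 Zrec.
have Zmono := homogeneous_nondecreasing b0 b1 k2 Z0 Zrec.
have Zge0 n : 0 <= Z n by apply: le_trans (Zmono 0%N n isT); rewrite Z0.
have k0R j : 0 < (k j)%:R :> R by rewrite ltr0n (leq_trans _ (k2 j)).
pose lam j : R := ln (k j)%:R.
pose lmax : R := \sum_j lam j.
have lam2 j : ln 2 <= lam j by rewrite ler_ln ?posrE// ler_nat.
have ln20 : 0 < ln 2 :> R by rewrite ln_gt0// ltr1n.
have lamP j : ln 2 <= lam j <= lmax.
  rewrite lam2/= /lmax (bigD1 j)//= lerDl; apply: sumr_ge0 => i _.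
  exact: le_trans (ltW ln20) (lam2 i).
have powE (x r : R) : 0 < x -> x `^ r = expR (r * ln x).
  by move=> x0; rewrite /powR gt_eqF.
pose p j := b j * (k j)%:R `^ (- s0).
have p0 j : 0 < p j by rewrite mulr_gt0// powR_gt0.
pose h t := Z (Num.truncn (expR t)) * expR (- (s0 * t)).
have hrec t : 0 <= t -> h t = \sum_j p j * h (t - lam j).
  move=> t0; rewrite /h Zrec ?truncn_gt0 -?expR0 ?ler_expR//.
  rewrite mulr_suml; apply: eq_bigr => j _.
  rewrite expRB lnK ?posrE// truncn_divn ?expR_ge0//; last exact: leq_trans (k2 j).
  rewrite /p powE// -/(lam j).
  have -> : expR (- (s0 * (t - lam j))) = expR (- (s0 * t)) / expR (- s0 * lam j).
    by rewrite -expRB; congr expR; ring.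
  by field; rewrite gt_eqF ?expR_gt0.
have h0 t : 0 <= h t by rewrite mulr_ge0 ?expR_ge0.
have hlow t : - lmax <= t < 0 -> h t <= expR (s0 * lmax).
  move=> /andP[t1 t2]; rewrite /h.
  have -> : Num.truncn (expR t) = 0%N by apply/truncn0Pn; rewrite -ltNge expR_lt1.
  by rewrite Z0 mul1r ler_expR -mulrN ler_pM2l// lerNl.
have hC t : 0 <= t -> h t <= expR (s0 * lmax).
  move=> t0; apply: (renewal_le p0 root ln20 lamP hrec (lexx 0)) => //.
    by move=> u; rewrite sub0r; exact: hlow.
  rewrite sub0r; apply: le_trans t0; rewrite oppr_le0; apply: sumr_ge0 => i _.
  exact: le_trans (ltW ln20) (lam2 i).
have hslow t d : 0 <= d -> expR (- (s0 * d)) * h t <= h (t + d).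
  move=> d0; rewrite /h mulrCA -expRD -opprD -mulrDr [d + t]addrC.
  rewrite ler_wpM2r ?expR_ge0//; apply/Zmono/le_truncn.
  by rewrite ler_expR lerDl.
have [S hS] := renewal_limit p0 root ln20 lamP hrec h0 hC s0p hslow irr.
have hn n i : (0 < n)%N -> (0 < i)%N ->
    Z (n %/ i)%N / n%:R `^ s0 = h (ln n%:R - ln i%:R) * i%:R `^ (- s0).
  move=> n0 i0; rewrite /h expRB !lnK ?posrE ?ltr0n// truncn_divn//.
  rewrite natrK -mulrA !powE ?ltr0n// -expRD -expRN.
  by congr (_ * expR _); ring.
exists (expR (s0 * lmax)), S; split; first exact: expR_gt0.
- move=> n n0; have := hn n 1%N n0 isT.
  rewrite divn1 ln1 subr0 powR1 mulr1 => hnE.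
  have n0R : 0 < n%:R `^ s0 :> R by rewrite powR_gt0// ltr0n.
  by rewrite -ler_pdivrMr// hnE hC// ln_ge0// ler1n.
- move=> i i0.
  have lim : h (ln n%:R - ln i%:R) @[n --> \oo] --> S.
    apply: (@cvg_comp _ _ _ (fun n => ln n%:R - ln i%:R) h _ _ _ _ hS).
    apply/cvgryPge => A; near=> n.
    rewrite lerBrDr -(expRK (A + _)) ler_ln ?posrE ?expR_gt0//.
      near: n; exact: nbhs_infty_ger.
    rewrite ltr0n; near: n; exact: nbhs_infty_gt.
  have : h (ln n%:R - ln i%:R) * i%:R `^ (- s0) @[n --> \oo] --> S * i%:R `^ (- s0).
    by apply: cvgM => //; exact: cvg_cst.
  apply: cvg_trans; apply: near_eq_cvg; near=> n.
  rewrite hn//; near: n; exact: nbhs_infty_gt.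
Unshelve. all: by end_near.
Qed.

(** The solution operator of the recursion.  The sequence of quotients by a
    fixed [i], [n |-> Z (n %/ i)], still satisfies the homogeneous recursion
    except when [n < i], where the defect is [D = \sum_j b j - 1] ([Zstep]).  In
    the difference for [i] and [i.+1] the defects cancel unless [n = i], so that
    after division by [D] exactly the unit input at time [i] is left ([Grec]).
    Using [maxn i 1] lets the bound cover the index [0]. *)
Lemma recursion_expansion (R : realType) (m : nat) (b : 'I_m -> R)
    (k : 'I_m -> nat) (s0 : R) :
  (forall j, 0 < b j) -> 1 < \sum_j b j -> (forall j, (2 <= k j)%N) ->
  (exists j l : 'I_m, irrational (ln (k j)%:R / ln (k l)%:R : R)) ->
  0 < s0 -> \sum_j b j * (k j)%:R `^ (- s0) = 1 ->
  exists (G : nat -> nat -> R) (c : nat -> R) (C : R), [/\ 0 < C,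
    forall n i, (0 < n)%N -> (i <= n)%N ->
      `|G n i| <= C * n%:R `^ s0 * (maxn i 1)%:R `^ (- s0),
    forall i, G n i / n%:R `^ s0 @[n --> \oo] --> c i &
    forall a X : nat -> R, X 0%N = a 0%N ->
      (forall n, (0 < n)%N -> X n = a n + \sum_j b j * X (n %/ k j)%N) ->
      forall n, X n = \sum_(i < n.+1) G n i * a i].
Proof.
move=> b0 b1 k2 irr s0p root.
have [Z [Z0 Zrec]] := exists_homogeneous b k2.
have Zmono := homogeneous_nondecreasing b0 (ltW b1) k2 Z0 Zrec.
have Zge0 n : 0 <= Z n by apply: le_trans (Zmono 0%N n isT); rewrite Z0.
have [C [S [C0 ZC Zlim]]] :=
  homogeneous_asymptotics b0 (ltW b1) k2 irr s0p root Z0 Zrec.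
pose D := \sum_j b j - 1.
have D0 : 0 < D by rewrite subr_gt0.
pose G n i := if i is i'.+1 then (Z (n %/ i)%N - Z (n %/ i.+1)%N) / D else Z n.
have G_big n i : (n < i)%N -> G n i = 0.
  by case: i => [//|i] ni; rewrite /G !divn_small ?subrr ?mul0r// ltnW.
have Zstep q : \sum_j b j * Z (q %/ k j)%N = Z q + (q == 0%N)%:R * D.
  case: q => [|q]; last by rewrite -Zrec// mul0r addr0.
  under eq_bigr do rewrite div0n Z0 mulr1.
  by rewrite Z0 mul1r /D addrC subrK.
have Grec n i : (0 < n)%N -> G n i = (i == n)%:R + \sum_j b j * G (n %/ k j)%N i.
  case: i => [|i] n0; first by rewrite /G -Zrec// [0%N == n]eq_sym gtn_eqF// add0r.
  rewrite /G; under eq_bigr do rewrite mulrA mulrBr -!divnMA ![(k _ * _)%N]mulnC !divnMA.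
  rewrite -mulr_suml sumrB !Zstep.
  have zE q : (n %/ q.+1 == 0)%N = (n < q.+1)%N.
    by rewrite -leqn0 [LHS]leqNgt divn_gt0// -ltnNge.
  rewrite !zE; have [ni|ni|->] := ltngtP n i.+1.
  - by rewrite (ltnW ni : (n < i.+2)%N)/=; field; rewrite gt_eqF.
  - by rewrite ltnNge ni/=; field; rewrite gt_eqF.
  - by rewrite ltnSn/=; field; rewrite gt_eqF.
exists G, (fun i => if i is i'.+1 then
  S * (i%:R `^ (- s0) - i.+1%:R `^ (- s0)) / D else S), (C + C / D).
split; first by rewrite addr_gt0// divr_gt0.
- move=> n [|i] n0 ni.
    rewrite powR1 mulr1 (ger0_norm (Zge0 n : 0 <= G n 0%N)) mulrDl.
    apply: le_trans (ZC _ n0) _.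
    by rewrite lerDl mulr_ge0 ?powR_ge0// ltW// divr_gt0.
  have q0 : (0 < n %/ i.+1)%N by rewrite divn_gt0.
  rewrite /G normrM (gtr0_norm (_ : 0 < D^-1)) ?invr_gt0//.
  rewrite ger0_norm ?subr_ge0 ?Zmono ?leq_div2l//.
  apply: (@le_trans _ _ (Z (n %/ i.+1)%N / D)).
    by rewrite ler_pM2r ?invr_gt0// lerBlDr lerDl.
  apply: (@le_trans _ _ (C / D * n%:R `^ s0 * (maxn i.+1 1)%:R `^ (- s0))); last first.
    rewrite ler_wpM2r ?powR_ge0// ler_wpM2r ?powR_ge0// lerDr ltW//.
  rewrite [leRHS](_ : _ = C * (n%:R `^ s0 * (maxn i.+1 1)%:R `^ (- s0)) / D); last first.
    by field; rewrite gt_eqF.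
  rewrite ler_pM2r ?invr_gt0//; apply: le_trans (ZC _ q0) _.
  rewrite ler_pM2l// (maxn_idPl _)// powRN ler_pdivlMr ?powR_gt0 ?ltr0n//.
  rewrite -powRM ?ler0n// (ge0_ler_powR (ltW s0p)) ?nnegrE ?mulr_ge0 ?ler0n//.
  by rewrite -natrM ler_nat leq_divM.
- move=> [|i].
    have := Zlim 1%N isT; rewrite powR1 mulr1.
    by under eq_fun do rewrite divn1.
  rewrite [X in _ --> X](_ : _ = (S * i.+1%:R `^ (- s0) - S * i.+2%:R `^ (- s0)) / D);
    last by rewrite mulrBr.
  under eq_fun do rewrite /G mulrAC mulrBl.
  by apply: cvgM; [apply: cvgB; exact: Zlim|exact: cvg_cst].
- move=> a X X0 Xrec.
  have main N n : (n < N)%N -> X n = \sum_(i < N) G n i * a i.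
    elim/ltn_ind: n N => n ih N nN.
    have [n0|n0] := posnP n.
      rewrite n0 in nN *; case: N nN => // N _.
      rewrite X0 big_ord_recl big1 => [|i _]; last by rewrite G_big ?mul0r.
      by rewrite addr0 /= Z0 mul1r.
    rewrite Xrec//.
    under eq_bigr => j _.
      rewrite (ih _ _ N) ?ltn_Pdiv//; last first.
        exact: leq_ltn_trans (leq_div _ _) nN.
      over.
    under [RHS]eq_bigr do rewrite Grec// mulrDl mulr_suml.
    rewrite big_split/= exchange_big/=; congr (_ + _).
      rewrite (bigD1 (Ordinal nN))//= eqxx mul1r big1 ?addr0// => i iN.
      by rewrite (negPf (_ : (i : nat) != n)) ?mul0r.
    apply: eq_bigr => j _; rewrite mulr_sumr; apply: eq_bigr => i _.
    by rewrite mulrA.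
  by move=> n; exact: main.
Qed.

(** * Series *)

(** Dominated convergence for series.  After subtracting the limits [c i], the
    terms tend to [0] and stay dominated by [2 * v i], so that only finitely many
    of them matter. *)
Lemma tannery (R : realType) (g : nat -> nat -> R) (c v : nat -> R) :
  (forall n i, (i <= n)%N -> `|g n i| <= v i) -> cvgn (series v) ->
  (forall i, g n i @[n --> \oo] --> c i) ->
  exists l : R, \sum_(i < n.+1) g n i @[n --> \oo] --> l.
Proof.
move=> gv cv gc.
have v0 i : 0 <= v i by exact: le_trans (gv i i (leqnn i)).
have cV i : `|c i| <= v i.
  have lim : `|g n i| @[n --> \oo] --> `|c i| by apply: cvg_norm; exact: gc.
  rewrite -(cvg_lim _ lim)//; apply: limr_le; first exact: cvgP lim.
  by near=> n; apply: gv; near: n; exact: nbhs_infty_ge.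
have cc : cvgn (series c).
  by apply: normed_cvg; apply: (series_le_cvg _ v0) cv => n //=; exact: normr_ge0.
exists (limn (series c)).
suff dif : \sum_(i < n.+1) g n i - series c n.+1 @[n --> \oo] --> (0 : R).
  rewrite (_ : (fun n => \sum_(i < n.+1) g n i) =
      (fun n => \sum_(i < n.+1) g n i - series c n.+1) \+
      (fun n => series c n.+1)); last first.
    by apply/funext => n /=; rewrite subrK.
  rewrite -[limn _]add0r; apply: cvgD => //.
  by rewrite (cvg_shiftS (series c)).
apply/cvgrPdist_le => e e0.
have e4 : 0 < e / 4 by rewrite divr_gt0.
have [N _ hN] : \forall n \near \oo, `|limn (series v) - series v n| <= e / 4.
  by move/cvgrPdist_le : cv => /(_ _ e4).
have nd : {homo series v : n n' / (n <= n')%N >-> n <= n'}.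
  by apply/nondecreasing_seqP => n; rewrite seriesSr lerDl.
have hfin : \sum_(i < N) `|g n i - c i| @[n --> \oo] --> (0 : R).
  rewrite [X in _ --> X](_ : _ = \sum_(i < N) (0 : R)); last by rewrite big1.
  apply: cvg_big => [|i _]; first exact: add_continuous.
  apply/norm_cvg0P; apply/cvgr0Pnorm_le => d d0.
  near=> n; rewrite distrC; near: n.
  by move/cvgrPdist_le : (gc i) => /(_ _ d0).
have hfin' : \forall n \near \oo, \sum_(i < N) `|g n i - c i| <= e / 2.
  have e2 : 0 < e / 2 by rewrite divr_gt0.
  move/cvgr0Pnorm_le : hfin => /(_ _ e2); apply: filterS => n.
  exact: le_trans (ler_norm _).
near=> n.
have Nn : (N <= n)%N by near: n; exact: nbhs_infty_ge.
rewrite sub0r normrN /series/= big_mkord -sumrB.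
apply: le_trans (ler_norm_sum _ _ _) _.
rewrite -(big_mkord xpredT (fun i => `|g n i - c i|)) (big_cat_nat _ (leqW Nn))//=.
rewrite big_mkord.
have -> : e = e / 2 + e / 2 by field.
apply: lerD; first by near: n.
apply: (@le_trans _ _ (\sum_(N <= i < n.+1) 2 * v i)).
  rewrite big_nat_cond [leRHS]big_nat_cond; apply: ler_sum => i /andP[/andP[_ iN] _].
  by apply: le_trans (ler_normB _ _) _; rewrite mulr_natl mulr2n lerD// gv.
rewrite -mulr_sumr.
have -> : \sum_(N <= i < n.+1) v i = series v n.+1 - series v N.
  by rewrite sub_series_geq// leqW.
have h1 : series v n.+1 <= limn (series v) by exact: nondecreasing_cvgn_le.
have h2 := hN N (leqnn N); rewrite /= ger0_norm ?subr_ge0 in h2; last first.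
  exact: nondecreasing_cvgn_le.
lra.
Unshelve. all: by end_near.
Qed.

(** Grouping the terms of index [2 i] and [2 i + 1] gives
    [S (2 n) <= 2 + q S n] with [q = 2 ^ (1 - a) < 1], for the partial sums [S],
    hence [S n <= 2 / (1 - q)]. *)
Lemma cvg_pseries (R : realType) (a : R) : 1 < a ->
  cvgn (series (fun i : nat => (maxn i 1)%:R `^ (- a))).
Proof.
move=> a1; set f := fun i : nat => _.
have f0 i : 0 <= f i by exact: powR_ge0.
pose q : R := 2 `^ (1 - a).
have q0 : 0 <= q by exact: powR_ge0.
have q1 : q < 1.
  by rewrite /q /powR gt_eqF// expR_lt1 nmulr_rlt0 ?subr_lt0// ln_gt0// ltr1n.
have fmono i : f i.*2.+1 <= f i.*2.
  rewrite /f !powRN lef_pV2 ?posrE ?powR_gt0 ?ltr0n ?leq_max ?orbT//.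
  have a0 : 0 <= a by exact: le_trans (ltW a1).
  by rewrite (ge0_ler_powR a0) ?nnegrE ?ler0n// ler_nat; lia.
have fhalf i : (0 < i)%N -> f i.*2 + f i.*2.+1 <= q * f i.
  move=> i0; apply: (@le_trans _ _ (2 * f i.*2)).
    by rewrite mulr_natl mulr2n lerD2l.
  rewrite /f !(maxn_idPl _) ?double_gt0// -muln2 natrM powRM// mulrCA.
  by rewrite mulrC ler_wpM2r ?powR_ge0// /q powRD ?powRr1// ?implybT// pnatr_eq0 implybT.
have dbl j : series f j.+1.*2 <= 2 + q * series f j.+1.
  elim: j => [|j ih].
    rewrite /series/= big_nat_recr//= !big_nat1 /f !powR1 mulr1.
    by rewrite lerDl.
  rewrite [j.+2.*2]doubleS [series f j.+2]seriesSr mulrDr.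
  rewrite [leLHS]seriesSr [series f _.+1]seriesSr.
  by rewrite -[leLHS]addrA [leRHS]addrA lerD// fhalf.
have nd : {homo series f : n n' / (n <= n')%N >-> n <= n'}.
  by apply/nondecreasing_seqP => n; rewrite seriesSr lerDl.
apply: nondecreasing_is_cvgn => //.
exists (2 / (1 - q)) => _ [n _ <-].
apply: (le_trans (nd n n.+1 _)) => //.
have h1 : series f n.+1 <= series f n.+1.*2 by apply: nd; rewrite -addnn leq_addr.
rewrite ler_pdivlMr ?subr_gt0//; have := dbl n; lra.
Qed.

(** Convexity of the exponential, the missing weight being put at [0].  The proof
    adds up the inequalities between the exponential and its tangent at the
    weighted mean [x]. *)
Lemma expR_weighted_sum (R : realType) (w z : nat -> R) (n : nat) :
  (forall i, 0 <= w i) -> \sum_(i < n) w i <= 1 ->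
  expR (\sum_(i < n) w i * z i) <= 1 + \sum_(i < n) w i * expR (z i).
Proof.
move=> w0 w1; set x := \sum_(i < n) _ * z i; set W := \sum_(i < n) w i in w1.
have tangent y : expR x * (1 + (y - x)) <= expR y.
  by rewrite -[y in leRHS](subrK x) expRD mulrC ler_pM2r ?expR_gt0// expR_ge1Dx.
have : \sum_(i < n) w i * (expR x * (1 + (z i - x))) <= \sum_(i < n) w i * expR (z i).
  by apply: ler_sum => i _; rewrite ler_wpM2l.
have -> : \sum_(i < n) w i * (expR x * (1 + (z i - x))) =
    expR x * ((1 - x) * W + x).
  rewrite mulrDr /W /x !mulr_sumr -big_split/=; apply: eq_bigr => i _.
  by rewrite -/x; ring.
have : (1 - W) * (expR x * (1 + (0 - x))) <= (1 - W) * 1.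
  by rewrite ler_wpM2l ?subr_ge0//; apply: le_trans (tangent 0) _; rewrite expR0.
have W0 : 0 <= W by exact: sumr_ge0.
move: (\sum_(i < n) _) (expR x) => q e; nra.
Qed.

(** * Exponential moments under stochastic domination *)

Lemma measurable_expR_comp d (T : measurableType d) (R : realType) (c : R) (f : T -> R) :
  measurable_fun setT f -> measurable_fun setT (fun w => expR (c * f w)).
Proof.
move=> mf; apply: (@measurableT_comp _ _ _ _ _ _ expR setT (fun w => c * f w)) => //.
exact: measurable_funM.
Qed.

Lemma emeasurable_expR_comp d (T : measurableType d) (R : realType) (c : R) (f : T -> R) :
  measurable_fun setT f -> measurable_fun setT (fun w => (expR (c * f w))%:E).
Proof. by move=> mf; apply/measurable_EFinP; exact: measurable_expR_comp. Qed.

(** The expectation of a nonnegative variable is the integral of its tail.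
    Domination compares closed tails whereas this formula uses open ones; the
    right continuity of the latter makes up for the difference. *)
Lemma stoch_dominated_mgf d (T : measurableType d) (R : realType)
    (P : probability T R) (Z : T -> R) (nu : probability R R) (alpha : R) :
  measurable_fun setT Z -> 0 < alpha -> stoch_dominated P Z nu ->
  (\int[P]_w (expR (alpha * Z w))%:E <= \int[nu]_x (expR (alpha * x))%:E)%E.
Proof.
move=> mZ a0 dom.
have mY : measurable_fun setT (fun w => expR (alpha * Z w)).
  by apply: measurableT_comp => //; exact: measurable_funM.
have mY' : measurable_fun setT (fun x : R => expR (alpha * x)).
  exact: measurable_expR_comp.
pose Y : {RV P >-> R} := mfun_Sub (mem_set mY).
pose Y' : {RV nu >-> R} := mfun_Sub (mem_set mY').
have Y0 w : 0 <= Y w by exact: expR_ge0.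
have Y'0 x : 0 <= Y' x by exact: expR_ge0.
have := ge0_expectation_ccdf Y0; have := ge0_expectation_ccdf Y'0.
rewrite !unlock /= => -> ->.
have step r s : 0 <= r -> r < s -> (ccdf Y s <= ccdf Y' r)%E.
  move=> r0 rs; have s0 : 0 < s by exact: le_lt_trans rs.
  have E x : (s <= expR (alpha * x)) = (ln s / alpha <= x).
    by rewrite -[s in LHS]lnK ?posrE// ler_expR ler_pdivrMr// mulrC.
  apply: (@le_trans _ _ (P [set w | ln s / alpha <= Z w])).
    rewrite /ccdf /distribution/= /pushforward; apply: le_measure; rewrite ?inE.
    - exact: (measurable_funPTI Y (measurable_itv _)).
    - rewrite (_ : [set w | _] = Y @^-1` `[s, +oo[%classic).
        exact: (measurable_funPTI Y (measurable_itv _)).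
      by apply/seteqP; split => w /=; rewrite in_itv/= andbT E.
    - by move=> w /=; rewrite in_itv/= andbT -E => /ltW.
  apply: le_trans (dom _) _.
  rewrite /ccdf /distribution/= /pushforward; apply: le_measure; rewrite ?inE//.
  - exact: (measurable_funPTI Y' (measurable_itv _)).
  - by move=> x /=; rewrite !in_itv/= !andbT -E; exact: lt_le_trans.
apply: ge0_le_integral => //.
- apply: measurable_funTS; exact: ccdf_measurable.
- apply: measurable_funTS; exact: ccdf_measurable.
- move=> r /=; rewrite in_itv/= andbT => r0.
  have lim : ccdf Y s @[s --> r^'+] --> ccdf Y r by exact: ccdf_right_continuous.
  rewrite -(cvg_lim _ lim)//; apply: lime_le; first exact: cvgP lim.
  near=> s; apply: step => //.
Unshelve. all: by end_near.
Qed.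

(** By Fubini, the Laplace transform turns convolutions into products. *)
Lemma conv_pow_mgf (R : realType) (mu : probability R R) (c : R) (n : nat) :
  (\int[conv_pow mu n]_x (expR (c * x))%:E = (\int[mu]_x (expR (c * x))%:E) ^+ n)%E.
Proof.
have mE : measurable_fun setT (fun x : R => (expR (c * x))%:E).
  by exact: emeasurable_expR_comp.
have E0 (x : R) : (0 <= (expR (c * x))%:E)%E by rewrite lee_fin expR_ge0.
elim: n => [|n ih].
  by rewrite integral_dirac// diracT mul1e mulr0 expR0.
rewrite expeS /conv_pow iterS -/(conv_pow mu n) /convolution.
rewrite (ge0_integral_distribution _ mE E0).
rewrite fubini_tonelli1/=; last 2 first.
- apply: emeasurable_expR_comp; exact: Defs.measurable_add_pair.
- by move=> x; exact: E0.
have inner (x : R) : (\int[conv_pow mu n]_y (expR (c * Defs.add_pair (x, y)))%:E)%E =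
    ((expR (c * x))%:E * (\int[mu]_x (expR (c * x))%:E) ^+ n)%E.
  rewrite -ih -ge0_integralZl//.
  by apply: eq_integral => y _; rewrite /Defs.add_pair/= mulrDr expRD EFinM.
rewrite (eq_integral (fun x => (expR (c * x))%:E *
   (\int[mu]_x (expR (c * x))%:E) ^+ n)%E) => [|x _]; last exact: inner.
by rewrite ge0_integralZr// -ih integral_ge0.

Qed.

(** Bounded in [n]: by convexity
    [expR (u / n) <= 1 + expR u / n], so the expectation is at most
    [1 + K / n <= expR (K / n)]. *)
Lemma mgf_pow_bounded (R : realType) (mu : probability R R) (alpha K : R) (n : nat) :
  (0 < n)%N -> 0 < alpha -> (\int[mu]_x (expR (alpha * `|x|))%:E <= K%:E)%E ->
  ((\int[mu]_x (expR (alpha / n%:R * x))%:E) ^+ n <= (expR K)%:E)%E.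
Proof.
move=> n0 a0 hK; have nR : 0 < n%:R :> R by rewrite ltr0n.
have mE c : measurable_fun setT (fun x : R => (expR (c * x))%:E).
  by exact: emeasurable_expR_comp.
have mA : measurable_fun setT (fun x : R => (expR (alpha * `|x|))%:E).
  by apply: emeasurable_expR_comp; exact: normr_measurable.
have pw x : expR (alpha / n%:R * x) <= 1 + n%:R^-1 * expR (alpha * `|x|).
  have h : expR (n%:R^-1 * (alpha * `|x|)) <= 1 + n%:R^-1 * expR (alpha * `|x|).
    have := @expR_weighted_sum _ (fun=> n%:R^-1) (fun=> alpha * `|x|) 1.
    rewrite !big_ord1; apply; first by rewrite invr_ge0.
    by rewrite invf_le1// ler1n.
  apply: le_trans h; rewrite ler_expR mulrAC mulrC ler_pM2l ?invr_gt0//.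
  by rewrite ler_pM2l// ler_norm.
have hA : (\int[mu]_x (expR (alpha / n%:R * x))%:E <= (1 + n%:R^-1 * K)%:E)%E.
  apply: (@le_trans _ _ (\int[mu]_x (1 + n%:R^-1%:E * (expR (alpha * `|x|))%:E))%E).
    apply: ge0_le_integral => //.
    - by apply: emeasurable_funD => //; exact: measurable_funeM.
    - by move=> x _; rewrite -EFinM -EFinD lee_fin.
  rewrite ge0_integralD//; last exact: measurable_funeM.
  rewrite ge0_integralZl//.
  have -> : (\int[mu]__ 1 = 1)%E by rewrite integral_cst// mul1e; exact: probability_setT.
  rewrite EFinD EFinM leeD2l//.
  by rewrite lee_wpmul2l// lee_fin invr_ge0.
have A0 : (0 <= \int[mu]_x (expR (alpha / n%:R * x))%:E)%E.
  by apply: integral_ge0 => x _; rewrite lee_fin expR_ge0.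
move: A0 hA; case: (\int[mu]_x _)%E => [r| |]//; rewrite !lee_fin => r0 hr.
rewrite -EFin_expe lee_fin.
have -> : expR K = expR (n%:R^-1 * K) ^+ n.
  by rewrite -expRM_natl mulVKf// gt_eqF.
apply: lerXn2r; rewrite ?nnegrE ?expR_ge0//; apply: le_trans hr _.
exact: expR_ge1Dx.
Qed.

(** Domination enters the rest of the proof only through a uniform bound on
    exponential moments: of a fixed order here, and of an order divided by the
    number of summands in the case of convolution powers. *)
Lemma dominated_mgf d (T : measurableType d) (R : realType) (P : probability T R)
    (a : nat -> {RV P >-> R}) :
  (exists2 mu : probability R R, law_exp_moments mu &
     forall n, stoch_dominated P (fun w => `|a n w|) mu) ->
  exists alpha K : R, 0 < alpha /\
    forall i, (\int[P]_w (expR (alpha * `|a i w|))%:E <= K%:E)%E.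
Proof.
move=> [mu [alpha a0]]; rewrite unlock => hmu dom.
have mA : measurable_fun setT (fun x : R => (expR (alpha * `|x|))%:E).
  by apply: emeasurable_expR_comp; exact: normr_measurable.
have I0 : (0 <= \int[mu]_x (expR (alpha * `|x|))%:E)%E.
  by apply: integral_ge0 => x _; rewrite lee_fin expR_ge0.
exists alpha, (fine (\int[mu]_x (expR (alpha * `|x|))%:E)%E); split => // i.
rewrite fineK ?ge0_fin_numE//.
apply: le_trans (stoch_dominated_mgf _ a0 (dom i)) _; first exact: measurableT_comp.
apply: ge0_le_integral => //; first exact: emeasurable_expR_comp.
by move=> x _; rewrite lee_fin ler_expR ler_pM2l// ler_norm.
Qed.

Lemma conv_dominated_mgf d (T : measurableType d) (R : realType) (P : probability T R)
    (a : nat -> {RV P >-> R}) :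
  (exists2 mu : probability R R, law_exp_moments mu &
     forall n, stoch_dominated P (fun w => `|a n w|) (conv_pow mu n)) ->
  exists alpha K : R, 0 < alpha /\
    forall i, (\int[P]_w (expR (alpha / (maxn i 1)%:R * `|a i w|))%:E <= K%:E)%E.
Proof.
move=> [mu [alpha a0]]; rewrite unlock => hmu dom.
have I0 : (0 <= \int[mu]_x (expR (alpha * `|x|))%:E)%E.
  by apply: integral_ge0 => x _; rewrite lee_fin expR_ge0.
pose K := fine (\int[mu]_x (expR (alpha * `|x|))%:E)%E.
have K0 : 0 <= K by exact: fine_ge0.
exists alpha, (expR K); split => // i.
have i0 : 0 < alpha / (maxn i 1)%:R by rewrite divr_gt0// ltr0n leq_max orbT.
apply: le_trans (stoch_dominated_mgf _ i0 (dom i)) _; first exact: measurableT_comp.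
rewrite conv_pow_mgf; case: i {i0} => [|i].
  by rewrite expe0 lee_fin -expR0 ler_expR.
rewrite (maxn_idPl _)//; apply: mgf_pow_bounded => //.
by rewrite fineK// ge0_fin_numE.
Qed.

(** * An integrable majorant for all weighted sums *)

(** [Y = 1 + \sum_i w i expR (Z i)] bounds the exponentials of all partial
    sums at once by convexity, and its expectation is at most [1 + K]. *)
Lemma exp_majorant d (T : measurableType d) (R : realType) (P : probability T R)
    (Z : nat -> T -> R) (w : nat -> R) (K : R) :
  (forall i, measurable_fun setT (Z i)) ->
  (forall i, (\int[P]_x (expR (Z i x))%:E <= K%:E)%E) ->
  (forall i, 0 <= w i) -> (forall n, \sum_(i < n) w i <= 1) ->
  exists Y : T -> \bar R, [/\ measurable_fun setT Y, (forall x, 0 <= Y x)%E,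
    (\int[P]_x Y x < +oo)%E &
    forall n x, ((expR (\sum_(i < n) w i * Z i x))%:E <= Y x)%E].
Proof.
move=> mZ hK w0 w1.
pose f i x := ((w i)%:E * (expR (Z i x))%:E)%E.
have mE i : measurable_fun setT (fun x => (expR (Z i x))%:E).
  by have := emeasurable_expR_comp 1 (mZ i); under eq_fun do rewrite mul1r.
have E0 i x : (0 <= (expR (Z i x))%:E)%E by rewrite lee_fin expR_ge0.
have wE i : (0 <= (w i)%:E)%E by rewrite lee_fin.
have f0 i x : (0 <= f i x)%E by rewrite mule_ge0.
have mf i : measurable_fun setT (f i) by exact: measurable_funeM.
have K0 : 0 <= K.
  by rewrite -lee_fin; apply: le_trans (hK 0%N); apply: integral_ge0 => x _; exact: E0.
have mS : measurable_fun setT (fun x => \sum_(0 <= i <oo) f i x)%E.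
  exact: ge0_emeasurable_sum.
have S0 x : (0 <= \sum_(0 <= i <oo) f i x)%E by exact: nneseries_ge0.
exists (fun x => 1 + \sum_(0 <= i <oo) f i x)%E; split.
- exact: emeasurable_funD.
- by move=> x; rewrite adde_ge0.
- rewrite ge0_integralD//.
  have -> : (\int[P]__ 1 = 1)%E by rewrite integral_cst// mul1e; exact: probability_setT.
  rewrite integral_nneseries//.
  apply: (@le_lt_trans _ _ (1 + K%:E)%E); last by rewrite -EFinD ltry.
  rewrite leeD2l//; apply: lime_le.
    by apply: is_cvg_nneseries => i _ _; exact: integral_ge0.
  near=> n; rewrite big_mkord.
  apply: (@le_trans _ _ (\sum_(i < n) (w i * K)%:E)%E).
    apply: lee_sum => i _; rewrite /f ge0_integralZl// EFinM.
    exact: lee_wpmul2l.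
  by rewrite sumEFin lee_fin -mulr_suml ler_piMl.
- move=> n x; apply: (@le_trans _ _ (1 + \sum_(i < n) f i x)%E).
    rewrite /f; under [X in (_ <= 1 + X)%E]eq_bigr do rewrite -EFinM.
    rewrite sumEFin -EFinD lee_fin.
    exact: (@expR_weighted_sum _ w (Z^~ x) n w0 (w1 n)).
  rewrite leeD2l// -(big_mkord xpredT (fun i => f i x)).
  exact: nneseries_lim_ge.
Unshelve. all: by end_near.
Qed.

Lemma exp_moments_le d (T : measurableType d) (R : realType) (P : probability T R)
    (V : T -> R) (beta : R) (Y : T -> \bar R) :
  measurable_fun setT V -> 0 < beta ->
  measurable_fun setT Y -> (forall x, 0 <= Y x)%E -> (\int[P]_x Y x < +oo)%E ->
  {ae P, forall x, ((expR (beta * `|V x|))%:E <= Y x)%E} ->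
  exp_moments P (fun x => `|V x|).
Proof.
move=> mV b0 mY Y0 Yoo VY; exists beta => //; rewrite unlock.
apply: le_lt_trans Yoo; apply: ae_ge0_le_integral => //.
- apply: emeasurable_expR_comp; under eq_fun do rewrite normr_id.
  exact: measurableT_comp.
- by apply: filterS VY => x h _; rewrite normr_id.
Qed.

Lemma measurable_recursion d (T : measurableType d) (R : realType) (m : nat)
    (b : 'I_m -> R) (k : 'I_m -> nat) (a X : nat -> T -> R) :
  (forall j, (2 <= k j)%N) ->
  (forall n, measurable_fun setT (a n)) ->
  (forall w, X 0%N w = a 0%N w) ->
  (forall n w, (0 < n)%N -> X n w = a n w + \sum_j b j * X (n %/ k j)%N w) ->
  forall n, measurable_fun setT (X n).
Proof.
move=> k2 ma X0 Xrec; elim/ltn_ind => -[|n] ih.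
  by rewrite (_ : X 0%N = a 0%N)//; apply/funext.
rewrite (_ : X n.+1 = fun w => a n.+1 w + \sum_j b j * X (n.+1 %/ k j)%N w); last first.
  by apply/funext => w; exact: Xrec.
apply: measurable_funD => //; apply: measurable_sum => j.
by apply: measurable_funM => //; apply: ih; rewrite ltn_Pdiv.
Qed.

(** The factor [kappa i] is the scale of [a i]: the input [a i / kappa i] has a
    bounded exponential moment, and the weight of this normalized input is
    [om i * kappa i]. *)
Lemma expansion_majorant d (T : measurableType d) (R : realType) (P : probability T R)
    (a : nat -> T -> R) (kappa : nat -> R) (alpha K : R) (om : nat -> R) (W : R) :
  (forall n, measurable_fun setT (a n)) -> (forall i, 0 < kappa i) ->
  0 < alpha ->
  (forall i, (\int[P]_w (expR (alpha / kappa i * `|a i w|))%:E <= K%:E)%E) ->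
  (forall i, 0 <= om i) -> 0 < W -> (forall n, \sum_(i < n) om i * kappa i <= W) ->
  exists beta (Y : T -> \bar R), [/\ 0 < beta, measurable_fun setT Y,
    (forall w, 0 <= Y w)%E, (\int[P]_w Y w < +oo)%E &
    forall n w, ((expR (beta * \sum_(i < n) om i * `|a i w|))%:E <= Y w)%E].
Proof.
move=> ma k0 a0 hK om0 W0 hW.
have [||||Y [mY Y0 Yoo hY]] := @exp_majorant d T R P
  (fun i w => alpha / kappa i * `|a i w|) (fun i => om i * kappa i / W) K.
- by move=> i; apply: measurable_funM => //; exact: measurableT_comp.
- exact: hK.
- by move=> i; rewrite divr_ge0 ?(ltW W0)// mulr_ge0// ltW.
- by move=> n; rewrite -mulr_suml ler_pdivrMr// mul1r.
exists (alpha / W), Y; split => //; first exact: divr_gt0.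
move=> n w; apply: le_trans (hY n w); rewrite lee_fin ler_expR mulr_sumr.
apply: ler_sum => i _; rewrite le_eqVlt; apply/orP; left; apply/eqP.
have := k0 i; have := W0; move=> /lt0r_neq0 ? /lt0r_neq0 ?.
by field; apply/andP.
Qed.

(** * Convergence of the normalized recursion *)

(** The majorant [Y] is used three times.  Where it is finite, which holds
    almost surely, it bounds the partial sums of [om i * `|a i|], so the limit
    exists by dominated convergence; and it bounds
    [expR (beta * `|X n / n ^ s0|)] for all [n], hence also the exponential of the
    limit.  Defining [L] as a limit superior makes it measurable everywhere. *)
Lemma recursion_converges d (T : measurableType d) (R : realType) (P : probability T R)
    (m : nat) (b : 'I_m -> R) (k : 'I_m -> nat) (s0 : R)
    (a X : nat -> T -> R) (kappa : nat -> R) (alpha K : R) :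
  (forall j, 0 < b j) -> 1 < \sum_j b j -> (forall j, (2 <= k j)%N) ->
  (exists j l : 'I_m, irrational (ln (k j)%:R / ln (k l)%:R : R)) ->
  0 < s0 -> \sum_j b j * (k j)%:R `^ (- s0) = 1 ->
  (forall n, measurable_fun setT (a n)) ->
  (forall w, X 0%N w = a 0%N w) ->
  (forall n w, (0 < n)%N -> X n w = a n w + \sum_j b j * X (n %/ k j)%N w) ->
  (forall i, 0 < kappa i) -> 0 < alpha ->
  (forall i, (\int[P]_w (expR (alpha / kappa i * `|a i w|))%:E <= K%:E)%E) ->
  cvgn (series (fun i : nat => (maxn i 1)%:R `^ (- s0) * kappa i)) ->
  exists2 L : {RV P >-> R},
    {ae P, forall w, (X n w / (n%:R `^ s0)) @[n --> \oo] --> L w} &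
    exp_moments P (fun w => `|L w|).
Proof.
move=> b0 b1 k2 irr s0p root ma X0 Xrec k0 a0 hK ck.
have [G [c [C [C0 GC Gc GX]]]] := recursion_expansion b0 b1 k2 irr s0p root.
have mX := measurable_recursion k2 ma X0 Xrec.
pose om i := C * (maxn i 1)%:R `^ (- s0).
have om0 i : 0 <= om i by rewrite mulr_ge0 ?powR_ge0// ltW.
set u := fun i : nat => _ in ck.
have u0 i : 0 <= u i by rewrite mulr_ge0 ?powR_ge0// ltW.
have nd : {homo series u : n n' / (n <= n')%N >-> n <= n'}.
  by apply/nondecreasing_seqP => n; rewrite seriesSr lerDl.
have lu0 : 0 <= limn (series u).
  by apply: le_trans (nondecreasing_cvgn_le nd ck 0%N); rewrite /series/= big_nil.
have [|n|beta [Y [beta0 mY Y0 Yoo hY]]] := @expansion_majorant d T R P a kappa alpha K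
  om (C * limn (series u) + 1) ma k0 a0 hK om0.
- by rewrite ltr_wpDl// mulr_ge0// ltW.
- apply: (@le_trans _ _ (C * series u n)).
    rewrite /series/= big_mkord mulr_sumr; apply: ler_sum => i _.
    by rewrite /om /u mulrA.
  by rewrite -[leLHS]addr0 lerD// ler_pM2l// nondecreasing_cvgn_le.
have XE n w : X n w = \sum_(i < n.+1) G n i * a i w.
  by apply: (GX (a^~ w) (X^~ w)) => // q; exact: Xrec.
pose g w n i := G n i / n%:R `^ s0 * a i w.
have gv w n i : (i <= n)%N -> `|g w n i| <= om i * `|a i w|.
  move=> ni; rewrite /g normrM ler_wpM2r// normrM.
  have [->|n0] := posnP n.
    by rewrite powR0 ?gt_eqF// invr0 normr0 mulr0.
  have ns : 0 < n%:R `^ s0 by rewrite powR_gt0// ltr0n.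
  rewrite (gtr0_norm (_ : 0 < (n%:R `^ s0)^-1)) ?invr_gt0// ler_pdivrMr//.
  by apply: le_trans (GC n i n0 ni) _; rewrite /om mulrAC.
have Xg w n : X n w / n%:R `^ s0 = \sum_(i < n.+1) g w n i.
  by rewrite XE mulr_suml; apply: eq_bigr => i _; rewrite /g mulrAC.
have XY w n : ((expR (beta * `|X n w / n%:R `^ s0|))%:E <= Y w)%E.
  apply: le_trans (hY n.+1 w); rewrite lee_fin ler_expR ler_pM2l// Xg.
  apply: le_trans (ler_norm_sum _ _ _) _; apply: ler_sum => i _.
  by apply: gv; rewrite -ltnS.
have cX w : Y w \is a fin_num -> exists l : R, X n w / n%:R `^ s0 @[n --> \oo] --> l.
  move=> Yf.
  have [||l hl] := @tannery R (g w) (fun i => c i * a i w)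
    (fun i => om i * `|a i w|) (gv w).
  - apply: nondecreasing_is_cvgn.
      by apply/nondecreasing_seqP => n; rewrite seriesSr lerDl mulr_ge0.
    exists (fine (Y w) / beta) => _ [n _ <-].
    rewrite ler_pdivlMr// mulrC -lee_fin fineK//; apply: le_trans (hY n w).
    rewrite lee_fin /series/= big_mkord; apply: le_trans (expR_ge1Dx _).
    by rewrite lerDr.
  - by move=> i; apply: cvgM => //; exact: cvg_cst.
  by exists l; under eq_fun do rewrite Xg.
pose L0 w : R := fine (limn_esup (fun n => (X n w / n%:R `^ s0)%:E)).
have mL0 : measurable_fun setT L0.
  apply: (@measurableT_comp _ _ _ _ _ _ (@fine R) setT
    (fun w => limn_esup (fun n => (X n w / n%:R `^ s0)%:E))).
    exact: fine_measurable.
  apply: measurable_fun_limn_esup => n; apply/measurable_EFinP.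
  exact: measurable_funM.
have cL w : Y w \is a fin_num -> X n w / n%:R `^ s0 @[n --> \oo] --> L0 w.
  move=> /cX[l hl]; suff -> : L0 w = l by [].
  rewrite /L0 (cvg_limn_einf_sup (_ : _ --> l%:E)).2//.
  by apply: cvg_EFin hl; exact: nearW.
have Yae : {ae P, forall w, Y w \is a fin_num}.
  have iY : P.-integrable setT Y.
    apply/integrableP; split => //.
    by under eq_integral do rewrite gee0_abs//.
  by apply: filterS (integrable_ae measurableT iY) => w; apply.
pose L : {RV P >-> R} := mfun_Sub (mem_set mL0).
exists L; first by apply: filterS Yae => w; exact: cL.
apply: (@exp_moments_le _ _ _ P L beta Y) => //.
apply: filterS Yae => w Yf /=.
rewrite -(fineK Yf) lee_fin.
have lim : expR (beta * `|X n w / n%:R `^ s0|) @[n --> \oo] --> expR (beta * `|L0 w|).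
  apply: continuous_cvg; first exact: continuous_expR.
  apply: cvgM; first exact: cvg_cst.
  by apply: cvg_norm; exact: cL.
rewrite -(cvg_lim _ lim)//; apply: limr_le; first exact: cvgP lim.
by near=> n; rewrite -lee_fin fineK.
Unshelve. all: by end_near.
Qed.

(** Each term [b j * k j ^ (- s)] decreases strictly with [s]. *)
Lemma root_gt (R : realType) (m : nat) (b : 'I_m -> R) (k : 'I_m -> nat) (s s0 : R) :
  (1 <= m)%N -> (forall j, 0 < b j) -> (forall j, (2 <= k j)%N) ->
  \sum_j b j * (k j)%:R `^ (- s0) = 1 ->
  s < s0 <-> 1 < \sum_j b j * (k j)%:R `^ (- s).
Proof.
move=> m1 b0 k2 root.
have mono (x y : R) j : x < y -> (k j)%:R `^ (- y) < (k j)%:R `^ (- x) :> R.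
  move=> xy; have kj : 1 < (k j)%:R :> R by rewrite ltr1n.
  rewrite /powR !gt_eqF ?(lt_trans _ kj)// ltr_expR ltr_pM2r ?ln_gt0//.
  by rewrite ltrN2.
rewrite -[X in X < \sum_(_ < _) _]root; split=> [ss|].
  apply: ltr_sum; last by move=> j _; rewrite ltr_pM2l// mono.
  by apply/hasP; exists (Ordinal m1); rewrite // mem_index_enum.
apply: contraTlt; rewrite -leNgt le_eqVlt => /predU1P[->//|ss].
by apply: ler_sum => j _; rewrite ler_pM2l// ltW// mono.
Qed.

Theorem theorem4 (R : realType) (d : measure_display) (T : measurableType d)
    (P : probability T R)
    (m : nat) (hm : (1 <= m)%N)
    (b : 'I_m -> R) (hb : forall j, 0 < b j) (hb1 : 1 < \sum_(j < m) b j)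
    (k : 'I_m -> nat) (hk : forall j, (2 <= k j)%N)
    (hlog : exists j l : 'I_m, irrational (ln (k j)%:R / ln (k l)%:R : R))
    (s0 : R) (hs0 : 0 < s0)
    (hs0root : \sum_(j < m) b j * ((k j)%:R `^ (- s0)) = 1)
    (a : nat -> {RV P >-> R}) (ha : independent_seq a)
    (X : nat -> T -> R)
    (hX0 : forall w, X 0%N w = a 0%N w)
    (hX : forall n w, (1 <= n)%N ->
      X n w = a n w + \sum_(j < m) b j * X (n %/ k j)%N w) :
  [/\ (* (1) *)
      (exists2 mu : probability R R, law_exp_moments mu &
         forall n, stoch_dominated P (fun w => `|a n w|) (conv_pow mu n)) ->
      forall n, exp_moments P (fun w => `|X n w|),
      (* (2) *)
      (1 < s0 <-> 1 < \sum_(j < m) b j / (k j)%:R) /\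
      (1 < s0 ->
       (exists2 mu : probability R R, law_exp_moments mu &
          forall n, stoch_dominated P (fun w => `|a n w|) mu) ->
       exists2 L : {RV P >-> R},
         {ae P, forall w, (X n w / (n%:R `^ s0)) @[n --> \oo] --> L w} &
         exp_moments P (fun w => `|L w|)) &
      (* (3) *)
      (2 < s0 <-> 1 < \sum_(j < m) b j / ((k j)%:R ^+ 2)) /\
      (2 < s0 ->
       (exists2 mu : probability R R, law_exp_moments mu &
          forall n, stoch_dominated P (fun w => `|a n w|) (conv_pow mu n)) ->
       exists2 L : {RV P >-> R},
         {ae P, forall w, (X n w / (n%:R `^ s0)) @[n --> \oo] --> L w} &
         exp_moments P (fun w => `|L w|))].
Proof.
have ma n : measurable_fun setT (a n) by exact: measurable_funP.
have mX := measurable_recursion hk ma hX0 hX.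
have max0 i : 0 < (maxn i 1)%:R :> R by rewrite ltr0n leq_max orbT.
split; [|split|split].
- move=> /conv_dominated_mgf[alpha [K [a0 hK]]] n.
  have [G [c [C [C0 _ _ GX]]]] := recursion_expansion hb hb1 hk hlog hs0 hs0root.
  (* For a fixed [n] the weights are those of [X n] itself. *)
  pose om i := if (i <= n)%N then `|G n i| else 0.
  have om0 i : 0 <= om i by rewrite /om; case: ifP.
  pose t i : R := om i * (maxn i 1)%:R.
  have t0 i : 0 <= t i by rewrite mulr_ge0// ltW.
  have [|N|beta [Y [beta0 mY Y0 Yoo hY]]] := @expansion_majorant d T R P a
    (fun i => (maxn i 1)%:R) alpha K om (\sum_(i < n.+1) t i + 1) ma max0 a0 hK om0.
  + by rewrite ltr_wpDl// sumr_ge0.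
  + apply: (@le_trans _ _ (\sum_(i < n.+1) t i)); last by rewrite lerDl.
    rewrite -(big_mkord xpredT t) -[leRHS](big_mkord xpredT t).
    have [Nn|nN] := leqP N n.+1.
      by rewrite [leRHS](big_cat_nat _ Nn)//= lerDl; apply: sumr_ge0.
    have tail : \sum_(n.+1 <= i < N) t i = 0.
      rewrite big_nat_cond big1// => i /andP[/andP[ni _] _].
      by rewrite /t /om leqNgt ni mul0r.
    by rewrite (big_cat_nat _ (ltnW nN))//= tail addr0.
  apply: (exp_moments_le (mX n) beta0 mY Y0 Yoo); apply: nearW => w.
  apply: le_trans (hY n.+1 w); rewrite lee_fin ler_expR ler_pM2l//.
  rewrite (GX (a^~ w) (X^~ w))//; last by move=> q; exact: hX.
  apply: le_trans (ler_norm_sum _ _ _) _; apply: ler_sum => i _.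
  by rewrite normrM /om -ltnS ltn_ord.
- have := root_gt 1 hm hb hk hs0root.
  by under eq_bigr do rewrite powR_inv1 ?ler0n//.
- move=> s1 /dominated_mgf[alpha [K [a0 hK]]].
  apply: (recursion_converges hb hb1 hk hlog hs0 hs0root ma hX0 hX
    (fun=> ltr01) a0 (K := K)).
    by move=> i; rewrite divr1.
  by under eq_fun do rewrite mulr1; exact: cvg_pseries.
- have := root_gt 2 hm hb hk hs0root.
  by under eq_bigr do rewrite powRN powR_mulrn ?ler0n//.
- move=> s2 /conv_dominated_mgf[alpha [K [a0 hK]]].
  apply: (recursion_converges hb hb1 hk hlog hs0 hs0root ma hX0 hX
    max0 a0 hK).
  have := @cvg_pseries R (s0 - 1); rewrite ltrBrDr => /(_ s2).
  rewrite opprB; under eq_fun do rewrite powRD ?powRr1 ?ler0n ?(gt_eqF (max0 _)) ?implybT//.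
  by under eq_fun do rewrite mulrC.
Qed.
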